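(* Let $\Lambda$ be an $A$-lattice. Then the norm on $\Lambda$ extends to a unique $\infty$-adic norm on the vector space $V_\infty=F_\infty\otimes_A\Lambda$.
   Context: $F$ is a global function field, $\infty$ a place of $F$, $A\subset F$ the ring of elements regular outside $\infty$, $F_\infty$ the $\infty$-adic completion with residue field of cardinality $c$, and $|\cdot|_\infty$ the absolute value on $F_\infty$ with $|\pi|_\infty=c^{-1}$ for a uniformizer $\pi$. An $A$-lattice is a finitely generated projective $A$-module $\Lambda$ with a function $\|\cdot\|\colon\Lambda\to\mathbb{R}_{\geqslant0}$ such that $\|\lambda\|=0\iff\lambda=0$, $\|\lambda+\lambda'\|\leqslant\max\{\|\lambda\|,\|\lambda'\|\}$, $\|a\lambda\|=|a|_\infty\|\lambda\|$ for all $a\in A$, and the norm induces the discrete topology on $\Lambda$ (equivalently, $\{\lambda:\|\lambda\|\leqslant r\}$ is finite for every $r>0$). An $\infty$-adic norm on an $F_\infty$-vector space $W$ is a function $W\to\mathbb{R}_{\geqslant0}$ vanishing only at $0$, satisfying the ultrametric inequality and $\|xw\|=|x|_\infty\|w\|$ for $x\in F_\infty$. Here $\Lambda$ is identified with its image $1\otimes\Lambda$ in $V_\infty$. *)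

(* Defs.v *)
From HB Require Import structures.
From mathcomp Require Import all_boot all_order all_algebra all_field.
From mathcomp Require Import generic_quotient ring_quotient.
From mathcomp Require Import boolp classical_sets functions cardinality reals.

Set Implicit Arguments.
Unset Strict Implicit.
Unset Printing Implicit Defensive.

Import Order.TTheory GRing.Theory Num.Theory.

Local Open Scope ring_scope.

(* Normalized discrete valuations.  The value +oo at 0 is replaced by the
   conventional value 0, so that two valuations agreeing on K^* are equal as
   functions; every use below treats 0 separately. *)
Record valuation (K : fieldType) := Valuation {
  ord :> K -> int;
  ord0 : ord 0 = 0;
  ordM : forall x y, x != 0 -> y != 0 -> ord (x * y) = ord x + ord y;
  ordD : forall x y, x != 0 -> y != 0 -> x + y != 0 ->
    Num.min (ord x) (ord y) <= ord (x + y);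
  ord_surj : exists x, ord x = 1
}.

(* A place of a global function field is the same thing as a normalized
   discrete valuation; such a valuation vanishes on the finite constant field. *)
Notation place := valuation (only parsing).

Section ValuationTheory.
Variables (K : fieldType) (v : valuation K).

(* v x >= n, with v 0 = +oo *)
Definition ord_ge (n : int) (x : K) : bool := (x == 0) || (n <= v x).

Lemma ord1 : v 1 = 0.
Proof.
have := ordM v (oner_neq0 K) (oner_neq0 K).
by rewrite mulr1 => /eqP; rewrite -subr_eq subrr eq_sym => /eqP.
Qed.

Lemma ordN1 : v (-1) = 0.
Proof.
have n0 : (-1 : K) != 0 by rewrite oppr_eq0 oner_neq0.
have := ordM v n0 n0; rewrite mulrNN mulr1 ord1 => /esym/eqP.
by rewrite -mulr2n mulrn_eq0 /= => /eqP.
Qed.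

Lemma ord_geM m n x y : ord_ge m x -> ord_ge n y -> ord_ge (m + n) (x * y).
Proof.
rewrite /ord_ge mulf_eq0.
case: (eqVneq x 0) => //= x0; case: (eqVneq y 0) => //= y0.
by rewrite ordM // => ? ?; apply: lerD.
Qed.

Lemma ord_geN n x : ord_ge n x -> ord_ge n (- x).
Proof.
rewrite -mulN1r -[X in ord_ge X (_ * _)]add0r; apply: ord_geM.
by rewrite /ord_ge ordN1 lexx orbT.
Qed.

Lemma ord_geD n x y : ord_ge n x -> ord_ge n y -> ord_ge n (x + y).
Proof.
rewrite /ord_ge; have [->|x0] := eqVneq x 0; first by rewrite add0r.
have [->|y0] := eqVneq y 0; first by rewrite addr0 => + _; rewrite (negPf x0).
have [//|xy0] := eqVneq (x + y) 0 => /= nx ny.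
by apply: le_trans (ordD v x0 y0 xy0); rewrite le_min nx ny.
Qed.

Lemma ord_geB n x y : ord_ge n x -> ord_ge n y -> ord_ge n (x - y).
Proof. by move=> ? /ord_geN; apply: ord_geD. Qed.

Definition regular_at : {pred K} := ord_ge 0.

Lemma regular_at_subring : subring_closed regular_at.
Proof.
split; first by rewrite unfold_in /regular_at /ord_ge ord1 lexx orbT.
- by move=> x y; apply: ord_geB.
- by move=> x y hx hy; have := ord_geM hx hy; rewrite addr0.
Qed.
HB.instance Definition _ :=
  GRing.isSubringClosed.Build K regular_at regular_at_subring.

Definition valuation_ring := {x : K | x \in regular_at}.
HB.instance Definition _ := Choice.on valuation_ring.
HB.instance Definition _ := SubType.on valuation_ring.
HB.instance Definition _ :=
  [SubChoice_isSubComNzRing of valuation_ring by <:].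

Definition maximal_ideal : {pred valuation_ring} :=
  fun x => ord_ge 1 (val x).

Lemma maximal_ideal_closed : idealr_closed maximal_ideal.
Proof.
split; first by rewrite unfold_in /ord_ge rmorph0 eqxx.
- by rewrite unfold_in /ord_ge rmorph1 oner_eq0 ord1.
- move=> a x y; rewrite !unfold_in rmorphD rmorphM => hx hy.
  apply: ord_geD hy; rewrite -[X in ord_ge X](add0r 1).
  by apply: ord_geM hx; apply: (valP a).
Qed.
HB.instance Definition _ :=
  isIdealr.Build valuation_ring maximal_ideal maximal_ideal_closed.

Definition residue_field := {ideal_quot maximal_ideal}.

(* The absolute value attached to v, normalized by |pi| = c^-1 (c is meant to be
   the cardinality of the residue field). *)
Definition absv (R : realType) (c : nat) (x : K) : R :=
  if x == 0 then 0 else c%:R ^ (- v x).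

End ValuationTheory.

Section RegularOutside.
Variables (F : fieldType) (infty : place F).

Definition regular_outside : {pred F} :=
  fun x => `[< forall P : place F, ord P <> ord infty -> x \in regular_at P >].

Lemma regular_outside_subring : subring_closed regular_outside.
Proof.
split; first by apply/asboolP => P _; apply: rpred1.
- by move=> x y /asboolP hx /asboolP hy; apply/asboolP => P nP;
    apply: rpredB; [apply: hx|apply: hy].
- by move=> x y /asboolP hx /asboolP hy; apply/asboolP => P nP;
    apply: rpredM; [apply: hx|apply: hy].
Qed.
HB.instance Definition _ :=
  GRing.isSubringClosed.Build F regular_outside regular_outside_subring.

Definition regular_ring := {x : F | x \in regular_outside}.
HB.instance Definition _ := Choice.on regular_ring.
HB.instance Definition _ := SubType.on regular_ring.
HB.instance Definition _ :=
  [SubChoice_isSubComNzRing of regular_ring by <:].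

End RegularOutside.

(* (K, w), together with iota, is a completion of (F, v): a complete valued
   field containing F as a dense subfield, with w extending v. *)
Record is_completion (F K : fieldType) (v : valuation F) (w : valuation K)
    (iota : {rmorphism F -> K}) : Prop := IsCompletion {
  completion_ext : forall x, w (iota x) = v x;
  completion_dense : forall (y : K) (n : int), exists x, ord_ge w n (y - iota x);
  completion_complete : forall u : nat -> K,
    (forall n : int, exists N : nat, forall i j : nat,
       (N <= i)%N -> (N <= j)%N -> ord_ge w n (u i - u j)) ->
    exists l : K, forall n : int, exists N : nat, forall i : nat,
       (N <= i)%N -> ord_ge w n (u i - l)
}.

Definition finitely_generated (A : comNzRingType) (M : lmodType A) : Prop :=
  exists (n : nat) (e : 'I_n -> M),
    forall x, exists a : 'I_n -> A, x = \sum_i a i *: e i.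

Definition projective (A : comNzRingType) (P : lmodType A) : Prop :=
  forall (M N : lmodType A) (g : {linear M -> N}) (f : {linear P -> N}),
    (forall y, exists x, g x = y) ->
    exists h : {linear P -> M}, forall x, g (h x) = f x.

(* M with norm nM is a lattice over A, where absA is the absolute value of A. *)
Record is_lattice (R : realType) (A : comNzRingType) (absA : A -> R)
    (M : lmodType A) (nM : M -> R) : Prop := IsLattice {
  lattice_fg : finitely_generated M;
  lattice_proj : projective M;
  lattice_ge0 : forall x, 0 <= nM x;
  lattice_eq0 : forall x, nM x = 0 <-> x = 0;
  lattice_ultra : forall x y, nM (x + y) <= Num.max (nM x) (nM y);
  lattice_homog : forall a x, nM (a *: x) = absA a * nM x;
  (* every point is isolated for the metric nM (y - x) *)
  lattice_discrete : forall x, exists2 e : R, 0 < e &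
    forall y, nM (y - x) < e -> y = x
}.

Record is_adic_norm (R : realType) (K : fieldType) (absK : K -> R)
    (W : lmodType K) (nW : W -> R) : Prop := IsAdicNorm {
  adic_ge0 : forall x, 0 <= nW x;
  adic_eq0 : forall x, nW x = 0 <-> x = 0;
  adic_ultra : forall x y, nW (x + y) <= Num.max (nW x) (nW y);
  adic_homog : forall a x, nW (a *: x) = absK a * nW x
}.

Definition balanced (A : comNzRingType) (K : fieldType)
    (f : A -> K) (M : lmodType A) (G : zmodType) (b : K -> M -> G) : Prop :=
  [/\ forall x y m, b (x + y) m = b x m + b y m,
      forall x m n, b x (m + n) = b x m + b x n &
      forall x a m, b (x * f a) m = b x (a *: m)].

(* V, with (x, m) |-> t x m standing for x (x) m, is the tensor product of K
   and M over A (K being an A-algebra through f), with its K-vector space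
   structure by multiplication on the left factor: t is the universal
   A-balanced biadditive map to an abelian group. *)
Record is_tensor_product (A : comNzRingType) (K : fieldType)
    (f : A -> K) (M : lmodType A) (V : lmodType K)
    (t : K -> M -> V) : Prop := IsTensorProduct {
  tensor_balanced : balanced f t;
  tensor_scale : forall x y m, x *: t y m = t (x * y) m;
  tensor_univ : forall (G : zmodType) (b : K -> M -> G), balanced f b ->
    exists2 g : {additive V -> G}, forall x m, g (t x m) = b x m &
      forall g' : {additive V -> G}, (forall x m, g' (t x m) = b x m) -> g' =1 g
}.

(* Main.v *)
From HB Require Import structures.
From mathcomp Require Import all_boot all_order all_algebra all_field.
From mathcomp Require Import generic_quotient ring_quotient.
From mathcomp Require Import boolp classical_sets functions cardinality reals.
From mathcomp Require Import zify ring lra.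
Require Import Defs.

(** The norm on V_infty is the tensor product seminorm, the infimum of
    max |x_j| |l_j| over all expressions v = sum x_j (x) l_j.  It restricts to the
    given norm on Lambda because F is dense in F_infty and small elements of
    Lambda, a direct summand of some A^n, have small norm.  It vanishes only at 0
    because A is cocompact in F_infty: if v had norm 0, a suitable difference of
    multiples of v would be close to a nonzero lattice vector of arbitrarily
    small norm.

    Cocompactness needs an element of F whose only pole is infty, which is
    obtained without Riemann-Roch.  Counting over the finite field k shows that,
    for every x in F, any n elements are k[x]-dependent, with n depending on x.
    Take x with a pole at infty, and let O be the ring of elements regular at all
    poles of x.  Then x has finitely many poles and O / x^-1 O is finite; hence
    every element of O[x] is the sum of one that is regular outside the poles of
    x and one from finitely many classes modulo O.  Weak approximation provides
    z whose only pole among those of x is infty; two powers of z get the same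
    class, and the difference of their first summands has infty as its only
    pole. *)

Set Implicit Arguments.
Unset Strict Implicit.
Unset Printing Implicit Defensive.

Import Order.TTheory GRing.Theory Num.Theory.

Local Open Scope classical_set_scope.
Local Open Scope ring_scope.

(** * Linear dependence over k[x] *)

Section FractionDenominators.
Variable R : idomainType.
Local Notation tofrac := (@FracField.tofrac R).

Lemma frac_den (f : {fraction R}) :
  exists2 d : R, d != 0 & exists q : R, tofrac d * f = tofrac q.
Proof.
elim/quotW: f => r; exists r.2; first exact: denom_ratioP.
exists r.1; unlock FracField.tofrac.
rewrite -[LHS]FracField.pi_mul; apply/eqmodP.
rewrite /= FracField.equivfE /FracField.mulf.
rewrite !numden_Ratio ?mul1r ?(oner_neq0, denom_ratioP) //.
by rewrite mulr1 mulrC.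
Qed.

Lemma frac_common_den (I : finType) (f : I -> {fraction R}) :
  exists2 d : R, d != 0 & forall i, exists q : R, tofrac d * f i = tofrac q.
Proof.
have [d dP] := choice (fun i => let: ex_intro2 d d0 h := frac_den (f i) in
  ex_intro (fun d => d != 0 /\ exists q, tofrac d * f i = tofrac q) d (conj d0 h)).
exists (\prod_i d i); first by apply/prodf_neq0 => i _; case: (dP i).
move=> i; have [_ [q hq]] := dP i.
exists ((\prod_(j | j != i) d j) * q).
by rewrite (bigD1 i) //= !rmorphM /= -hq mulrAC mulrC.
Qed.

End FractionDenominators.

Definition peval (k : nzRingType) (F : comNzRingType) (emb : {rmorphism k -> F})
  (x : F) (p : {poly k}) : F := (map_poly emb p).[x].

(** In the field case and for [x] transcendental over [k], this says that [F : k(x)] < n; for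
    algebraic [x] it holds as soon as n > 0. Families are total on [nat], and only their first [n]
    values count. *)
Definition poly_dependent (k : nzRingType) (F : comNzRingType)
    (emb : {rmorphism k -> F}) (x : F) (n : nat) :=
  forall y : nat -> F, exists p : nat -> {poly k},
    (exists2 i, (i < n)%N & p i != 0) /\ \sum_(i < n) peval emb x (p i) * y i = 0.

(** * Counting in a space spanned by finitely many elements over k(X) *)

Section Counting.
Variables (k : finFieldType) (F : fieldType) (poly_in : {rmorphism {poly k} -> F}).
Variables (n0 : nat) (b : 'I_n0 -> F).
Hypothesis poly_in_eq0 : forall p, poly_in p = 0 -> p = 0.
Hypothesis common_den : forall (I : finType) (z : I -> F),
  exists2 d : {poly k}, d != 0 & exists q : I -> 'I_n0 -> {poly k},
    forall i, poly_in d * z i = \sum_j poly_in (q i j) * b j.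

Let const_in : {rmorphism k -> F} := (poly_in \o polyC)%FUN.

(** For fixed [E] these elements form a finite k-space of dimension at most n0 E, the target of the
    counting. *)
Definition bounded_coords (E : nat) (z : F) :=
  exists2 q : 'I_n0 -> {poly k}, (forall i, size (q i) <= E)%N &
    z = \sum_i poly_in (q i) * b i.

Lemma bounded_coordsD E z z' :
  bounded_coords E z -> bounded_coords E z' -> bounded_coords E (z + z').
Proof.
move=> [q qE ->] [q' qE' ->]; exists (fun i => q i + q' i) => [i|].
  by apply: leq_trans (size_polyD _ _) _; rewrite geq_max qE qE'.
by rewrite -big_split /=; apply: eq_bigr => i _; rewrite (rmorphD poly_in) mulrDl.
Qed.

Lemma bounded_coords0 E : bounded_coords E 0.
Proof.
exists (fun=> 0); first by move=> i; rewrite size_poly0.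
by rewrite big1 // => i _; rewrite rmorph0 mul0r.
Qed.

Lemma bounded_coords_sum E (I : finType) (z : I -> F) :
  (forall i, bounded_coords E (z i)) -> bounded_coords E (\sum_i z i).
Proof.
by move=> h; apply: (big_ind (bounded_coords E)) => //;
  by [exact: bounded_coords0|exact: bounded_coordsD].
Qed.

Lemma bounded_coordsW E E' z :
  (E <= E')%N -> bounded_coords E z -> bounded_coords E' z.
Proof. by move=> EE' [q qE ->]; exists q => // i; apply: leq_trans (qE i) EE'. Qed.

Lemma bounded_coordsM E D (d : {poly k}) z : (size d <= D.+1)%N ->
  bounded_coords E z -> bounded_coords (E + D) (poly_in d * z).
Proof.
move=> dD [q qE ->]; exists (fun i => d * q i) => [i|].
  apply: leq_trans (size_polyMleq _ _) _.
  by have := qE i; lia.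
by rewrite mulr_sumr; apply: eq_bigr => i _; rewrite (rmorphM poly_in) mulrA.
Qed.

Lemma bounded_coords_den (I : finType) (z : I -> F) :
  exists2 d : {poly k}, d != 0 &
    exists E, forall i, bounded_coords E (poly_in d * z i).
Proof.
have [d d0 [q hq]] := common_den z.
exists d => //; exists (\max_u size (q u.1 u.2)) => i; exists (q i) => // j.
exact: (leq_bigmax (i, j)).
Qed.

Lemma bounded_coordsZ a z E : bounded_coords E z -> bounded_coords E (const_in a * z).
Proof.
move=> h; rewrite -(addn0 E); apply: bounded_coordsM h.
by rewrite size_polyC; case: eqP.
Qed.

(* Counting: with at most [s] powers of [x] and [n] elements there are
   |k|^(s n) combinations, but after clearing denominators they lie in a space
   of dimension n0 (E + s D), which is less than s n for n = n0 D + 1 and large s. *)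
Lemma counting_poly_dependent (x : F) :
  exists n, poly_dependent const_in x n.
Proof.
have [d d0 [D0 hD0]] := bounded_coords_den (fun i : 'I_n0 => x * b i).
(* Multiplying by d x or by d alone raises the bound by the same [D], so any mixture of the two has
   a fixed cost per factor. *)
pose D := maxn D0 (size d).
have mulx E z : bounded_coords E z -> bounded_coords (E + D) (poly_in d * x * z).
  move=> [q qE ->]; rewrite mulr_sumr; apply: bounded_coords_sum => i.
  rewrite mulrCA -mulrA [(E + _)%N]addnC.
  apply: bounded_coordsM; first by apply: leqW.
  by apply: bounded_coordsW (hD0 i); rewrite leq_maxl.
have muld E z : bounded_coords E z -> bounded_coords (E + D) (poly_in d * z).
  by apply: bounded_coordsM; rewrite leqW // leq_maxr.
pose n := (n0 * D).+1; exists n => y.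
have [d' d0' [E hE]] := bounded_coords_den (fun i : 'I_n => y i).
(* With s = n0 E, the n (s + 1) = (n0 D + 1)(s + 1) free coefficients outnumber the n0 (E + s D) = s
   + n0 D s coordinates. *)
pose s := (n0 * E)%N.
(* Of the j + l factors d, j accompany the powers of x and l are padding; with j + l = s, all x^j
   y_i get the one denominator d^s d'. *)
have pow j l i : bounded_coords (E + (j + l) * D)
    (poly_in d ^+ (j + l) * x ^+ j * (poly_in d' * y (i : 'I_n))).
  elim: j => [|j IH].
    rewrite add0n expr0 mulr1; elim: l => [|l IH]; first by rewrite expr0 mul1r addn0.
    by rewrite exprS -mulrA mulSn addnCA addnC; apply: muld.
  rewrite addSn exprS exprS mulSn addnCA addnC.
  have -> : poly_in d * poly_in d ^+ (j + l) * (x * x ^+ j) * (poly_in d' * y i) =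
    poly_in d * x * (poly_in d ^+ (j + l) * x ^+ j * (poly_in d' * y i)).
    by rewrite !mulrA; congr (_ * _ * _ * _); rewrite mulrAC.
  exact: mulx.
pose M := (E + s * D)%N.
pose T := {ffun 'I_n * 'I_s.+1 -> k}.
pose val (a : T) : F := \sum_u const_in (a u) * (x ^+ u.2 * y u.1).
have hval a : exists q : 'I_n0 -> {poly k}, (forall i, size (q i) <= M)%N /\
    poly_in d ^+ s * poly_in d' * val a = \sum_i poly_in (q i) * b i.
  suff: bounded_coords M (poly_in d ^+ s * poly_in d' * val a) by case=> q; exists q.
  rewrite mulr_sumr; apply: bounded_coords_sum => -[i j] /=.
  rewrite mulrCA; apply: bounded_coordsZ.
  have /subnKC es : (j <= s)%N by rewrite -ltnS.
  have := pow j (s - j)%N i; rewrite es; congr bounded_coords.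
  by rewrite !mulrA; congr (_ * _); rewrite mulrAC.
have [q hq] := choice hval.
pose Phi (a : T) : {ffun 'I_n0 * 'I_M -> k} := [ffun u : 'I_n0 * 'I_M => (q a u.1)`_(u.2 : 'I_M)].
have /fintype.injectivePn [a [a' aa' eqa]] : ~~ injectiveb Phi.
  apply/negP => /injectiveP /leq_card; rewrite !card_ffun !card_prod !card_ord; apply/negP.
  rewrite -ltnNge ltn_exp2l ?finNzRing_gt1 // /M /n /s.
  by nia.
have vE : val a = val a'.
  have c0 : poly_in d ^+ s * poly_in d' != 0.
    have nz p : p != 0 -> poly_in p != 0 by apply: contra_neq; apply: poly_in_eq0.
    by rewrite mulf_neq0 ?expf_neq0 ?nz.
  apply: (mulfI c0); have [sa ->] := hq a; have [sa' ->] := hq a'.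
  apply: eq_bigr => i _; congr (poly_in _ * _); apply/polyP => j.
  have [jM|jM] := ltnP j M; last by rewrite !nth_default ?(leq_trans _ jM).
  by have := congr1 (fun f : {ffun _ -> _} => f (i, Ordinal jM)) eqa; rewrite !ffunE.
pose p i := if insub i is Some i' then \poly_(j < s.+1) (a (i', inord j) - a' (i', inord j)) else 0.
have pE (i : 'I_n) : p i = \poly_(j < s.+1) (a (i, inord j) - a' (i, inord j)).
  by rewrite /p valK.
exists p; split.
  apply: contrapT => /forall2NP hn; case/eqP: aa'; apply/ffunP => -[i j].
  case: (hn i) => [/negP|/negP]; rewrite ?ltn_ord // negbK => /eqP.
  rewrite pE => /polyP /(_ j); rewrite coef_poly ltn_ord coef0 inord_val.
  by move/eqP; rewrite subr_eq0 => /eqP.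
have : val a - val a' = 0 by rewrite vE subrr.
pose G (i : 'I_n) (j : 'I_s.+1) := const_in (a (i, j) - a' (i, j)) * x ^+ j * y i.
rewrite -sumrB (eq_bigr (fun u => G u.1 u.2)) => [|[i j] _]; last first.
  by rewrite -mulrBl -(rmorphB const_in) mulrA.
rewrite -(pair_bigA _ G) /= => sum0; rewrite -[RHS]sum0.
apply: eq_bigr => i _; rewrite -mulr_suml; congr (_ * _).
rewrite /peval pE.
rewrite (@horner_coef_wide _ s.+1); last first.
  by rewrite size_map_poly size_poly.
by apply: eq_bigr => j _; rewrite coef_map coef_poly ltn_ord inord_val.
Qed.

End Counting.

Section FunctionField.
Variables (k : finFieldType) (F : fieldExtType {fraction {poly k}}).

Definition poly_in : {rmorphism {poly k} -> F} :=
  (in_alg F \o @FracField.tofrac _)%FUN.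
Definition const_in : {rmorphism k -> F} := (poly_in \o polyC)%FUN.

(** A basis of F over k(X) plays the role of [b]: the coordinates of finitely many elements have a
    common denominator. *)
Lemma function_field_poly_dependent (x : F) :
  exists n, poly_dependent const_in x n.
Proof.
apply: (@counting_poly_dependent k F poly_in _ (fun i => (vbasis {:F})`_i)).
  by move=> p /eqP; rewrite fmorph_eq0 tofrac_eq0 => /eqP.
move=> I z; pose b := vbasis {:F}.
have [d d0 hd] := frac_common_den (fun u : I * 'I_(\dim {:F}) => coord b u.2 (z u.1)).
exists d => //; have [q hq] := choice hd.
exists (fun i j => q (i, j)) => i.
rewrite {1}(coord_vbasis (memvf (z i))) mulr_sumr; apply: eq_bigr => j _.
rewrite -mulr_algl mulrA; congr (_ * _).
by have /= := congr1 (in_alg F) (hq (i, j)); rewrite -!in_algE rmorphM.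
Qed.

End FunctionField.

(** * Valuations and weak approximation *)

Section ValuationFacts.
Variables (K : fieldType) (v : valuation K).
Implicit Types x y z : K.

Lemma ord_neq0 x : v x != 0 -> x != 0.
Proof. by apply: contra_neq => ->; apply: ord0. Qed.

Lemma ord_lt0_neq0 x : v x < 0 -> x != 0.
Proof. by move=> vx; apply: ord_neq0; rewrite lt_eqF. Qed.

Lemma ordN x : v (- x) = v x.
Proof.
have [->|x0] := eqVneq x 0; first by rewrite oppr0.
by rewrite -mulN1r ordM ?oppr_eq0 ?oner_eq0 // ordN1 add0r.
Qed.

Lemma ordV x : v x^-1 = - v x.
Proof.
have [->|x0] := eqVneq x 0; first by rewrite invr0 ord0 oppr0.
have := ordM v x0 (invr_neq0 x0); rewrite divff // ord1; lia.
Qed.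

Lemma ordX x n : v (x ^+ n) = v x * n%:Z.
Proof.
have [->|x0] := eqVneq x 0.
  by rewrite expr0n; case: n => [|n]; rewrite ?ord1 ord0 mul0r.
elim: n => [|n IH]; first by rewrite expr0 ord1 mulr0.
by rewrite exprS ordM ?expf_neq0 // IH; lia.
Qed.

Lemma ord_geE n x : x != 0 -> ord_ge v n x = (n <= v x).
Proof. by rewrite /ord_ge => /negbTE ->. Qed.

Lemma ord_ge_ord x : ord_ge v (v x) x.
Proof. by rewrite /ord_ge lexx orbT. Qed.

Lemma ord_ge_ge0 x : 0 <= v x -> ord_ge v 0 x.
Proof. by rewrite /ord_ge => ->; rewrite orbT. Qed.

Lemma ord_ge_0 n : ord_ge v n 0.
Proof. by rewrite /ord_ge eqxx. Qed.

Lemma ord_ge_trans m n x : m <= n -> ord_ge v n x -> ord_ge v m x.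
Proof.
by rewrite /ord_ge => mn /orP [->//|/(le_trans mn) ->]; rewrite orbT.
Qed.

Lemma ord_ge0M x y : ord_ge v 0 x -> ord_ge v 0 y -> ord_ge v 0 (x * y).
Proof. by move=> hx hy; have := ord_geM hx hy; rewrite addr0. Qed.

Lemma ord_ge0X x n : ord_ge v 0 x -> ord_ge v 0 (x ^+ n).
Proof.
move=> hx; elim: n => [|n IH]; last by rewrite exprS; apply: ord_ge0M.
by rewrite expr0 ord_ge_ge0 ?ord1.
Qed.

Lemma ord_ge_sum (I : finType) n (f : I -> K) :
  (forall i, ord_ge v n (f i)) -> ord_ge v n (\sum_i f i).
Proof.
by move=> h; apply: (big_ind (ord_ge v n)) => //; [apply: ord_ge_0|move=> *; apply: ord_geD].
Qed.

(** If y + z had order above v(y), so would y = (y + z) - z. *)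
Lemma ord_addl y z : y != 0 -> ord_ge v (v y + 1) z ->
  y + z != 0 /\ v (y + z) = v y.
Proof.
move=> y0 hz.
have yz0 : y + z != 0.
  apply: contraTneq hz => /eqP; rewrite addrC addr_eq0 => /eqP ->.
  by rewrite ord_geE ?oppr_eq0 // ordN; lia.
split=> //; apply/eqP; rewrite eq_le; apply/andP; split.
  rewrite leNgt; apply/negP => lt.
  have : ord_ge v (v y + 1) ((y + z) - z).
    by apply: ord_geB => //; rewrite ord_geE //; lia.
  by rewrite addrK ord_geE //; lia.
rewrite -ord_geE //; apply: ord_geD; first exact: ord_ge_ord.
by apply: ord_ge_trans hz; lia.
Qed.

(** Valuation rings are integrally closed: at a pole of y the left side has order (m + 1) v(y),
    below the bound m v(y) valid for every term on the right. *)
Lemma integral_regular m (f : 'I_m.+1 -> K) y :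
  (forall i, ord_ge v 0 (f i)) -> y ^+ m.+1 = \sum_i f i * y ^+ i ->
  ord_ge v 0 y.
Proof.
move=> hf hy; have [->|y0] := eqVneq y 0; first exact: ord_ge_0.
rewrite ord_geE // leNgt; apply/negP => vy.
have : ord_ge v (v y * m%:Z) (y ^+ m.+1).
  rewrite hy; apply: ord_ge_sum => i.
  have := ord_geM (hf i) (ord_ge_ord (y ^+ i)); rewrite add0r ordX.
  by apply: ord_ge_trans; have := ltn_ord i; nia.
by rewrite ord_geE ?expf_neq0 // ordX; lia.
Qed.

End ValuationFacts.

(** * Separating finitely many places *)

Section Approximation.
Variable F : fieldType.
Implicit Types v w P : place F.

(** Take a with a pole at v but not at w, and b with a pole at w but not at v; then a / b works. *)
Lemma separate_places v w : ord v <> ord w -> exists2 z : F, v z < 0 & 0 < w z.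
Proof.
have half u1 u2 : ord u1 <> ord u2 -> exists2 a : F, u1 a < 0 & 0 <= u2 a.
  (* Otherwise the valuation ring of [u2] lies in that of [u1]. Then [u1] is a multiple of [u2], and
     surjectivity makes the factor 1. *)
  move=> ne; apply: contrapT => no; apply: ne.
  have dom (a : F) : 0 <= u2 a -> 0 <= u1 a.
    by move=> h2; rewrite leNgt; apply/negP => h1; apply: no; exists a.
  have unit (a : F) : u2 a = 0 -> u1 a = 0.
    move=> h2; have := dom a; have := dom a^-1; rewrite !ordV h2; lia.
  have [pi hpi] := ord_surj u2; have pi0 : pi != 0 by apply: (@ord_neq0 _ u2); rewrite hpi.
  have scale (a : F) : u1 a = u1 pi * u2 a.
    have [->|a0] := eqVneq a 0; first by rewrite !ord0 mulr0.
    have [n hn] : exists n : nat, u2 a = n%:Z \/ u2 a = - n%:Z by exists `|u2 a|%N; lia.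
    have pn0 : pi ^+ n != 0 by rewrite expf_neq0.
    case: hn => hn; rewrite hn.
      have := @unit (a / pi ^+ n); rewrite !ordM ?invr_neq0 // !ordV !ordX hpi hn.
      by rewrite mul1r subrr => /(_ erefl) /eqP; rewrite subr_eq0 => /eqP.
    have := @unit (a * pi ^+ n); rewrite !ordM // !ordX hpi hn.
    by rewrite mul1r addNr mulrN => /(_ erefl) /eqP; rewrite addr_eq0 => /eqP.
  have [b hb] := ord_surj u1.
  have e1 : u1 pi = 1.
    have := scale b; have := dom pi; rewrite hb hpi => h2 h1.
    have {}h2 := h2 isT; have [q0|q0] := lerP (u2 b) 0; nia.
  by apply/funext => a; rewrite scale e1 mul1r.
move=> vw; have [a va wa] := half _ _ vw.
have [b wb vb] := half _ _ (fun e => vw (esym e)).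
have b0 := ord_lt0_neq0 wb; have a0 := ord_lt0_neq0 va.
by exists (a / b); rewrite ordM ?invr_neq0 // ordV; lia.
Qed.

(** Induction on [r], adding one place at a time. Indices with w_i = v are skipped, so the list may
    contain v. *)
Lemma separate_place_family v (w : nat -> place F) r :
  exists2 z : F, v z < 0 & forall i, (i < r)%N -> ord (w i) <> ord v -> 0 < w i z.
Proof.
elim: r => [|r [z vz hz]].
  by have [a ha] := ord_surj v; exists a^-1 => //; rewrite ordV ha.
have [e|ne] := pselect (ord (w r) = ord v).
  exists z => // i; rewrite ltnS leq_eqVlt => /orP [/eqP ->|]; last exact: hz.
  by rewrite e.
have [y vy wy] := separate_places (fun e => ne (esym e)).
have z0 := ord_lt0_neq0 vz; have y0 := ord_lt0_neq0 vy.
(* [N] exceeds every |w_i(y)|, so the zeros of z^N outweigh the poles of y at the earlier places. *)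
pose N := (\max_(i < r) `|w i y|)%N.+1.
have hN (i : nat) : (i < r)%N -> ord (w i) <> ord v -> 0 < w i (z ^+ N * y).
  move=> ir hi; rewrite ordM ?expf_neq0 // ordX.
  have := hz i ir hi.
  have : (`|w i y| <= \max_(j < r) `|w j y|)%N by apply: (leq_bigmax (Ordinal ir)).
  rewrite /N /=; set M := (\max_(_ < r) _)%N; nia.
have [wz|wz] := lerP 0 (w r z).
  exists (z ^+ N * y); first by rewrite ordM ?expf_neq0 // ordX; nia.
  move=> i; rewrite ltnS leq_eqVlt => /orP [/eqP ->|]; last exact: hN.
  by rewrite ordM ?expf_neq0 // ordX; nia.
(* multiplying by z^N / (1 + z^N) is harmless where z has a pole *)
have vzN P : P z < 0 -> 1 + z ^+ N != 0 /\ P (1 + z ^+ N) = P (z ^+ N).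
  move=> Pz; rewrite addrC; apply: ord_addl; first by rewrite expf_neq0.
  by rewrite ord_geE ?oner_neq0 // ord1 ordX /N; nia.
have [z1 vz1] := vzN v vz; have [_ wz1] := vzN (w r) wz.
exists (z ^+ N * y / (1 + z ^+ N)).
  by rewrite !ordM ?invr_neq0 ?expf_neq0 ?mulf_neq0 ?expf_neq0 // ordV vz1; lia.
move=> i; rewrite ltnS leq_eqVlt => /orP [/eqP -> _|ir hi].
  by rewrite !ordM ?invr_neq0 ?expf_neq0 ?mulf_neq0 ?expf_neq0 // ordV wz1; lia.
have := hN i ir hi; rewrite [in X in _ -> X]ordM ?invr_neq0 ?mulf_neq0 ?expf_neq0 //.
have [_ e] : 1 + z ^+ N != 0 /\ w i (1 + z ^+ N) = w i 1.
  apply: ord_addl; rewrite ?oner_neq0 // ord1 add0r.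
  by rewrite ord_geE ?expf_neq0 // ordX; have := hz i ir hi; rewrite /N; nia.
by rewrite ordV e ord1; lia.
Qed.

End Approximation.

(** * Elements with a single pole *)

Lemma pigeonhole (T : eqType) (S : seq T) (f : nat -> T) :
  (forall n, f n \in S) -> exists i j, (i < j)%N /\ f i = f j.
Proof.
move=> fS; pose s := mkseq f (size S).+1.
have /(uniqPn (f 0)) [i [j [ij]]] : ~~ uniq s.
  apply/negP => us; suff /(uniq_leq_size us) : {subset s <= S} by rewrite size_mkseq ltnn.
  by move=> _ /mapP [n _ ->].
rewrite size_mkseq => jS; rewrite !nth_mkseq ?(ltn_trans ij jS) // => e.
by exists i, j.
Qed.

Section PolynomialEvaluation.
Variables (k : nzRingType) (F : comNzRingType) (emb : {rmorphism k -> F}) (x : F).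
Local Notation ev := (peval emb x).

Lemma peval0 : ev 0 = 0.
Proof. by rewrite /peval rmorph0 horner0. Qed.

Lemma pevalXn n : ev 'X^n = x ^+ n.
Proof. by rewrite /peval map_polyXn hornerXn. Qed.

Lemma pevalC a : ev a%:P = emb a.
Proof. by rewrite /peval map_polyC hornerC. Qed.

Lemma pevalD p q : ev (p + q) = ev p + ev q.
Proof. by rewrite /peval rmorphD hornerD. Qed.

Lemma pevalMX p : ev (p * 'X) = ev p * x.
Proof. by rewrite /peval rmorphM /= map_polyX hornerMX. Qed.

Lemma pevalM p q : ev (p * q) = ev p * ev q.
Proof. by rewrite /peval rmorphM hornerM. Qed.

End PolynomialEvaluation.

Section Places.
Variables (k : finFieldType) (F : fieldType) (emb : {rmorphism k -> F}).
Hypothesis dependent : forall x, exists n, poly_dependent emb x n.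
Local Notation ev := (peval emb).
Implicit Types P v : place F.

(** Since a^|k| = a, the order u satisfies |k| u = u with |k| > 1. *)
Lemma ord_const P a : P (emb a) = 0.
Proof.
have [->|a0] := eqVneq a 0; first by rewrite rmorph0 ord0.
have := congr1 (fun b => P (emb b)) (expf_card a); rewrite rmorphXn ordX.
have := finNzRing_gt1 k; move: #|_| (P (emb a)) => q u q1 h.
  by case: (ltrgt0P u) => // u0; nia.
Qed.

Lemma ord_ge_const P a : ord_ge P 0 (emb a).
Proof. by rewrite ord_ge_ge0 ?ord_const. Qed.

Lemma ord_ge_peval P x p : ord_ge P 0 x -> ord_ge P 0 (ev x p).
Proof.
move=> hx; elim/poly_ind: p => [|p c IH]; first by rewrite peval0 ord_ge_0.
rewrite pevalD pevalMX pevalC; apply: ord_geD; last exact: ord_ge_const.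
exact: ord_ge0M.
Qed.

(** Constants have order 0, so at a pole of x the leading term strictly dominates. In particular an
    [x] with a pole is transcendental over [k]. *)
Lemma ord_peval P x p : P x < 0 -> p != 0 ->
  ev x p != 0 /\ P (ev x p) = P x * ((size p).-1)%:Z.
Proof.
move=> Px; have x0 := ord_lt0_neq0 Px.
elim/poly_ind: p => [|p c IH]; first by rewrite eqxx.
rewrite size_MXaddC pevalD pevalMX pevalC.
have [->|p0] := eqVneq p 0.
  rewrite mul0r add0r polyC_eq0 peval0 mul0r add0r /= => c0.
  by rewrite (negbTE c0) fmorph_eq0 c0 ord_const size_poly0 mulr0.
move=> _ /=; have [e0 eP] := IH p0.
have sp : (0 < size p)%N by rewrite size_poly_gt0.
have : P (ev x p * x) = P x * (size p)%:Z by rewrite ordM // eP; nia.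
move=> <-; apply: ord_addl; first by rewrite mulf_neq0.
apply: ord_ge_trans (ord_ge_const P c); rewrite ordM // eP; nia.
Qed.

Lemma peval_neq0 P x p : P x < 0 -> p != 0 -> ev x p != 0.
Proof. by move=> Px /(ord_peval Px) []. Qed.

(** In a k[x]-relation between powers of y, let e = d(x) be the top nonzero coefficient: then e y is
    integral over k[x]. The pole at [P0] ensures that nonzero polynomials do not vanish at x. *)
Lemma integral_multiple P0 x y : P0 x < 0 ->
  exists2 d : {poly k}, d != 0 &
    forall P, ord_ge P 0 x -> ord_ge P 0 (ev x d * y).
Proof.
move=> P0x; have [n dep] := dependent x.
have [p [[i0 i0n pi0] sum0]] := dep (fun i => y ^+ i).
pose Q i := (i < n)%N && (p i != 0).
have exQ : exists i, Q i by exists i0; rewrite /Q i0n.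
have bQ i : Q i -> (i <= n)%N by case/andP => /ltnW.
have [m /andP [mn pm0] mmax] := ex_maxnP exQ bQ.
have {}sum0 : \sum_(i < m.+1) ev x (p i) * y ^+ i = 0.
  rewrite -[RHS]sum0 (big_ord_widen n (fun i => ev x (p i) * y ^+ i)) //.
  rewrite big_mkcond; apply: eq_bigr => i _; case: ltnP => // mi.
  suff -> : p i = 0 by rewrite peval0 mul0r.
  by apply/eqP; apply: contraLR mi => pi; rewrite -ltnNge ltnS mmax // /Q ltn_ord.
case: m => [|m] in mn pm0 mmax sum0 *.
  move: sum0; rewrite big_ord1 expr0 mulr1 => /eqP.
  by rewrite (negbTE (peval_neq0 P0x pm0)).
exists (p m.+1) => // P Px; set e := ev x (p m.+1).
(* The relation multiplied by e^m, read as a monic equation of degree m + 1 for e y. *)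
apply: (@integral_regular _ P m (fun i => - (ev x (p i) * e ^+ (m - i)))).
  move=> i; apply: ord_geN; apply: ord_ge0M; first exact: ord_ge_peval.
  by apply: ord_ge0X; apply: ord_ge_peval.
have -> : (e * y) ^+ m.+1 = e ^+ m * (e * y ^+ m.+1) by rewrite exprMn exprSr mulrA.
move: sum0; rewrite big_ord_recr /= addrC => /eqP; rewrite addr_eq0 => /eqP ->.
rewrite mulrN mulr_sumr -sumrN; apply: eq_bigr => i _.
have im : (i <= m)%N by rewrite -ltnS.
by rewrite -{1}(subnK im) exprD exprMn; ring.
Qed.

(* A place where z_i has a pole while all other z_j vanish detects z_i, so such
   z_i are linearly independent over k[x]: there are at most n poles of x. *)
Lemma finitely_many_poles v x : v x < 0 ->
  exists r (w : nat -> place F), forall P, P x < 0 -> ord P <> ord v ->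
    exists2 i, (i < r)%N & ord P = ord (w i).
Proof.
move=> vx; apply: contrapT => inf; have [n dep] := dependent x.
have fam r : exists w : nat -> place F, (forall i, (i < r)%N -> w i x < 0) /\
    (forall i j, (i < j < r)%N -> ord (w i) <> ord (w j)).
  elim: r => [|r [w [wx wd]]]; first by exists (fun=> v); split=> // i j /andP [].
  have [P Px Pw] : exists2 P : place F, P x < 0 & forall i, (i < r)%N -> ord P <> ord (w i).
    apply: contrapT => no; apply: inf; exists r, w => P Px _.
    apply: contrapT => no'; apply: no; exists P => // i ir e.
    by apply: no'; exists i.
  exists (fun i => if i == r then P else w i); split=> [i ir|i j /andP [ij jr]].
    by case: eqP => // ne; apply: wx; lia.
  have -> : (i == r) = false by apply/eqP; lia.
  case: eqP => [_ e|ne]; first by apply: (Pw i _ (esym e)); lia.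
  by apply: wd; lia.
have [w [wx wd]] := fam n.
have [z hz] := choice (fun i : nat =>
  let: ex_intro2 z h1 h2 := separate_place_family (w i) w n in
  ex_intro (fun z => w i z < 0 /\ forall j, (j < n)%N -> ord (w j) <> ord (w i) -> 0 < w j z)
    z (conj h1 h2)).
have [p [[i0 i0n pi0] sum0]] := dep z.
(* For i of maximal degree, the i-th term has strictly smallest order at w_i: no p_j(x) has a larger
   pole there than p_i(x), while z_i has a pole and the other z_j vanish. *)
have [i _ imax] := @arg_maxnP 'I_n (Ordinal i0n) predT (fun i => size (p i)) isT.
have pi : p i != 0.
  by have := imax (Ordinal i0n) isT; rewrite -!size_poly_gt0 in pi0 *; apply: leq_trans.
have [ei eP] := ord_peval (wx i (ltn_ord i)) pi.
have [zi wz] := hz i; have zi0 := ord_lt0_neq0 zi.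
move: sum0; rewrite (bigD1 i) //= => sum0.
have [||] := @ord_addl _ (w i) (ev x (p i) * z i) (\sum_(j < n | j != i) ev x (p j) * z j).
- by rewrite mulf_neq0.
- rewrite big_mkcond; apply: ord_ge_sum => j; case: eqP => [_|ji]; first exact: ord_ge_0.
  have [->|pj] := eqVneq (p j) 0; first by rewrite peval0 mul0r ord_ge_0.
  have [ej ePj] := ord_peval (wx i (ltn_ord i)) pj.
  have [-> |zj0] := eqVneq (z j) 0; first by rewrite mulr0 ord_ge_0.
  have [_ /(_ i (ltn_ord i)) wji] := hz j.
  have ne : ord (w i) <> ord (w j).
    have : (i < j)%N || (j < i)%N by case: ltngtP => // e; case: ji; apply: val_inj.
    by case/orP => h; [|move=> e; have := esym e]; apply: wd; rewrite h ltn_ord.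
  rewrite ord_geE ?mulf_neq0 // !ordM // ePj eP.
  have := wji ne; have := imax j isT; have := wx i (ltn_ord i); rewrite -size_poly_gt0 in pj.
  by move=> /=; nia.
- by rewrite sum0 eqxx.
Qed.

Lemma isolate_pole v x : v x < 0 ->
  exists2 z, v z < 0 & forall P, P x < 0 -> ord P <> ord v -> ord_ge P 0 z.
Proof.
move=> vx; have [r [w hw]] := finitely_many_poles vx.
have [z vz hz] := separate_place_family v w r; exists z => // P Px Pv.
have [i ir e] := hw P Px Pv; rewrite ord_ge_ge0 // e ltW //.
by apply: hz; rewrite -?e.
Qed.


(** For [x] with a pole, this is the integral closure in F of the valuation ring of k(x) at the pole
    of x. *)
Definition regular_at_poles (x y : F) := forall P, P x < 0 -> ord_ge P 0 y.

(** * Expansions in powers of x with finitely many digits *)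

Section Reduction.
Variables (v : place F) (x : F).
Hypothesis vx : v x < 0.
Let x0 : x != 0 := ord_lt0_neq0 vx.
Local Notation O := (regular_at_poles x).

Lemma regular_at_polesM y z : O y -> O z -> O (y * z).
Proof. by move=> hy hz P Px; apply: ord_ge0M; [apply: hy|apply: hz]. Qed.

Lemma regular_at_polesD y z : O y -> O z -> O (y + z).
Proof. by move=> hy hz P Px; apply: ord_geD; [apply: hy|apply: hz]. Qed.

Lemma regular_at_polesN y : O y -> O (- y).
Proof. by move=> hy P Px; apply: ord_geN; apply: hy. Qed.

Lemma regular_at_poles_const a : O (emb a).
Proof. by move=> P _; apply: ord_ge_const. Qed.

Lemma regular_at_poles_div d (p : {poly k}) : (size p <= d.+1)%N ->
  O (ev x p / x ^+ d).
Proof.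
move=> pd P Px; have [->|p0] := eqVneq p 0; first by rewrite peval0 mul0r ord_ge_0.
have [e0 eP] := ord_peval Px p0.
rewrite ord_ge_ge0 // ordM ?invr_neq0 ?expf_neq0 ?(ord_lt0_neq0 Px) // ordV ordX eP.
have : ((size p).-1 <= d)%N by lia.
move: (size p).-1 => s sd; nia.
Qed.

Lemma regular_at_poles_inv (p : {poly k}) : p != 0 -> O (ev x p)^-1.
Proof.
move=> p0 P Px; have [e0 eP] := ord_peval Px p0.
rewrite ord_ge_ge0 // ordV eP; nia.
Qed.

(* O / x^-1 O has k-dimension at most n: looking at leading coefficients, a
   family of O which is independent modulo x^-1 O is independent over k[x]. *)
Lemma finite_residues :
  exists S : seq F, forall y, O y -> exists2 s, s \in S & O (x * (y - s)).
Proof.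
pose indep r := exists y : nat -> F, (forall i, O (y i)) /\
  forall c : nat -> k, O (x * \sum_(i < r) emb (c i) * y i) ->
    forall i, (i < r)%N -> c i = 0.
(* A maximal size exists: n elements independent modulo x^-1 O would contradict dependence over
   k[x]. *)
have [r [y [yO yind]] ndep] : exists2 r, indep r & ~ indep r.+1.
  have [n dep] := dependent x; apply: contrapT => all.
  have step r : indep r -> indep r.+1.
    by move=> h; apply: contrapT => h'; apply: all; exists r.
  have [y [yO yind]] : indep n.
    elim: n {dep} => [|n IH]; last exact: step.
    by exists (fun=> 0); split=> // i P Px; apply: ord_ge_0.
  have [p [[i0 i0n pi0] sum0]] := dep y.
  have [i _ imax] := @arg_maxnP 'I_n (Ordinal i0n) predT (fun i => size (p i)) isT.
  have spi : (0 < size (p i))%N.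
    by have := imax (Ordinal i0n) isT; rewrite -size_poly_gt0 in pi0; apply: leq_trans.
  pose D := (size (p i)).-1.
  have sD (j : 'I_n) : (size (p j) <= D.+1)%N.
    by rewrite prednK //; apply: imax.
  suff lead : O (x * \sum_(j < n) emb (p j)`_D * y j).
    have := yind (fun j => (p j)`_D) lead i (ltn_ord i); apply/eqP.
    by rewrite -lead_coefE lead_coef_eq0 -size_poly_gt0.
  (* After division by x^D, only the coefficients of degree [D] survive modulo x^-1 O. *)
  have split_p (j : 'I_n) : p j = take_poly D (p j) + ((p j)`_D)%:P * 'X^D.
    rewrite -[LHS](poly_take_drop D); congr (_ + _ * _).
    apply/polyP => l; rewrite coef_drop_poly coefC; case: l => [|l] //=.
    by rewrite nth_default // (leq_trans (sD j)) // addSn ltnS leq_addl.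
  have -> : x * \sum_(j < n) emb (p j)`_D * y j =
      - (\sum_(j < n) (ev x (take_poly D (p j)) / x ^+ D * x) * y j).
    rewrite mulr_sumr; apply/eqP; rewrite -addr_eq0 -big_split /=.
    have xD : x ^+ D != 0 by rewrite expf_neq0.
    rewrite -(mulrI_eq0 _ (mulfI xD)) mulr_sumr.
    rewrite -(mulrI_eq0 _ (mulfI (invr_neq0 x0))) mulr_sumr -[X in _ == X]sum0.
    apply/eqP; apply: eq_bigr => j _.
    rewrite {3}(split_p j) pevalD pevalM pevalC pevalXn; field.
    by rewrite x0 xD.
  apply: regular_at_polesN => P Px; apply: ord_ge_sum => j.
  apply: ord_ge0M; last exact: yO.
  have st : (size (take_poly D (p j)) <= D)%N by rewrite size_take_poly.
  case: (D) st => [|d] st.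
    by move: st; rewrite leqn0 size_poly_eq0 => /eqP ->; rewrite peval0 !mul0r ord_ge_0.
  have -> : ev x (take_poly d.+1 (p j)) / x ^+ d.+1 * x = ev x (take_poly d.+1 (p j)) / x ^+ d.
    by rewrite exprS; field; rewrite x0 expf_neq0.
  exact: regular_at_poles_div st _ Px.
exists (codom (fun c : {ffun 'I_r -> k} => \sum_(i < r) emb (c i) * y i)) => z zO.
have [c [cO [i ir ci]]] : exists c : nat -> k,
    O (x * (\sum_(i < r) emb (c i) * y i + emb (c r) * z)) /\
    exists2 i, (i < r.+1)%N & c i != 0.
  apply: contrapT => no; apply: ndep.
  exists (fun i => if i == r then z else y i); split=> [i|c cO i ir].
    by case: eqP.
  apply/eqP; apply: contrapT => /negP ci; apply: no; exists c; split; last by exists i.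
  move: cO; rewrite big_ord_recr /= eqxx; congr (O (x * (_ + _))).
  by apply: eq_bigr => j _; rewrite ltn_eqF.
(* A relation without z would contradict the independence of the y_i; one involving z is solved for
   z. *)
have cr : c r != 0.
  apply: contraNneq ci => cr; move: cO; rewrite cr rmorph0 mul0r addr0 => /yind h.
  by move: ir; rewrite ltnS leq_eqVlt => /orP [/eqP ->|/h ->]; rewrite ?cr.
exists (\sum_(i < r) emb (- c i / c r) * y i).
  apply/codomP; exists [ffun i : 'I_r => - c i / c r].
  by apply: eq_bigr => j _; rewrite ffunE.
have -> : \sum_(i < r) emb (- c i / c r) * y i =
    - ((\sum_(i < r) emb (c i) * y i) / emb (c r)).
  rewrite mulr_suml -sumrN; apply: eq_bigr => j _.
  by rewrite mulNr rmorphN fmorph_div mulNr mulrAC.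
have ecr : emb (c r) != 0 by rewrite fmorph_eq0.
move: cO; set A := \sum_(i < r) _ => cO.
have -> : x * (z - - (A / emb (c r))) = emb (c r)^-1 * (x * (A + emb (c r) * z)).
  by rewrite fmorphV; field.
by apply: regular_at_polesM cO; apply: regular_at_poles_const.
Qed.

(** The case m = 1 iterated, giving successive digits in powers of 1/x. *)
Lemma finite_residues_pow m :
  exists S : seq F, forall y, O y -> exists2 s, s \in S & O (x ^+ m * (y - s)).
Proof.
have [S1 hS1] := finite_residues.
elim: m => [|m [S hS]].
  by exists [:: 0] => y yO; exists 0; rewrite ?mem_head // expr0 mul1r subr0.
exists [seq s + s1 / x ^+ m | s <- S, s1 <- S1] => y /hS [s sS /hS1 [s1 s1S]].
have xm : x ^+ m != 0 by rewrite expf_neq0.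
move=> h; exists (s + s1 / x ^+ m); first by apply/allpairsP; exists (s, s1).
by move: h; congr O; rewrite exprS; field.
Qed.

Lemma common_integral_multiple (S : seq F) :
  exists2 d : {poly k}, d != 0 & forall s, s \in S ->
    forall P, ord_ge P 0 x -> ord_ge P 0 (ev x d * s).
Proof.
elim: S => [|s S [d d0 hd]]; first by exists 1; rewrite ?oner_neq0.
have [e e0 he] := integral_multiple s vx.
exists (d * e) => [|s']; first by rewrite mulf_neq0.
rewrite inE pevalM => /orP [/eqP ->|s'S] P Px.
  by rewrite -mulrA; apply: ord_ge0M; [apply: ord_ge_peval|apply: he].
by rewrite mulrAC; apply: ord_ge0M; [apply: hd|apply: ord_ge_peval].
Qed.

(* Write y = d(x) y' with d(x) clearing the denominators of the residues, and
   expand y' in powers of x with residues as digits, down to the constant term. *)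
Lemma cofinite_reduction m :
  exists S : seq F, forall j y, O (y / x ^+ j) ->
    exists2 b, (forall P, ord_ge P 0 x -> ord_ge P 0 b) &
    exists2 s, s \in S & O (x ^+ m * (y - b - s)).
Proof.
have [S1 hS1] := finite_residues.
have [d d0 hd] := common_integral_multiple S1.
(* Each digit s removes the top power of x; d(x) times the sum b of the removed terms is regular
   wherever x is. *)
have digits j y : O (y / x ^+ j) ->
    exists2 b, (forall P, ord_ge P 0 x -> ord_ge P 0 (ev x d * b)) & O (y - b).
  elim: j y => [|j IH] y hy.
    exists 0; first by move=> P _; rewrite mulr0 ord_ge_0.
    by move: hy; rewrite expr0 divr1 subr0.
  have xj : x ^+ j != 0 by rewrite expf_neq0.
  have [s sS hs] := hS1 _ hy.
  have [|b hb yb] := IH (y - x ^+ j.+1 * s).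
    by move: hs; congr O; rewrite exprS; field; rewrite x0 xj.
  exists (b + x ^+ j.+1 * s) => [P Px|]; last by move: yb; congr O; ring.
  rewrite mulrDr mulrCA; apply: ord_geD; first exact: hb.
  by apply: ord_ge0M; [apply: ord_ge0X|apply: hd].
have e0 : ev x d != 0 by apply: peval_neq0 vx d0.
(* The extra precision deg d makes up for the final multiplication by d(x). *)
have [S hS] := finite_residues_pow (m + (size d).-1).
exists [seq ev x d * s | s <- S] => j y hy.
have [|b hb yb] := digits j (y / ev x d).
  have -> : y / ev x d / x ^+ j = y / x ^+ j * (ev x d)^-1 by rewrite mulrAC.
  by apply: regular_at_polesM; [|apply: regular_at_poles_inv].
have [s sS hs] := hS _ yb.
exists (ev x d * b) => //; exists (ev x d * s); first exact: map_f.
have dO : O (ev x d / x ^+ (size d).-1).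
  by apply: regular_at_poles_div; rewrite prednK // size_poly_gt0.
have := regular_at_polesM dO hs; congr O; rewrite exprD; field.
by rewrite e0 expf_neq0.
Qed.

End Reduction.

Lemma exists_single_pole v :
  exists2 t : F, v t < 0 & forall P, ord P <> ord v -> ord_ge P 0 t.
Proof.
have [x vx] : exists x : F, v x < 0.
  by have [a ha] := ord_surj v; exists a^-1; rewrite ordV ha.
have x0 := ord_lt0_neq0 vx.
have [z vz hz] := isolate_pole vx; have z0 := ord_lt0_neq0 vz.
have [S hS] := cofinite_reduction vx 0.
have {}hS N : exists u : F * F, (forall P, ord_ge P 0 x -> ord_ge P 0 u.1) /\
    (u.2 \in S /\ regular_at_poles x (z ^+ N - u.1 - u.2)).
  (* As v(x) <= -1, this power of x has at least the pole of z^N at v; at the other poles of x, z is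
     regular. *)
  have [|b hb [s sS hs]] := hS (N * `|v z|)%N (z ^+ N).
    move=> P Px; have [e|ne] := pselect (ord P = ord v).
      rewrite ord_ge_ge0 // e ordM ?invr_neq0 ?expf_neq0 // ordV !ordX.
      rewrite e in Px; rewrite PoszM; have : v z = - (`|v z|%N)%:Z by lia.
      move: (`|v z|)%N => q ->; nia.
    apply: ord_ge0M; first by apply: ord_ge0X; apply: hz.
    by rewrite ord_ge_ge0 // ordV ordX; nia.
  by exists (b, s); split=> //; split=> //; move: hs; rewrite expr0 mul1r.
have [u hu] := choice hS.
have [i [j [ij eij]]] := pigeonhole (fun N => (hu N.+1).2.1).
have hO : regular_at_poles x ((z ^+ j.+1 - (u j.+1).1) - (z ^+ i.+1 - (u i.+1).1)).
  have := regular_at_polesD (hu j.+1).2.2 (regular_at_polesN (hu i.+1).2.2).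
  by rewrite eij; congr regular_at_poles; ring.
set h := (X in regular_at_poles x X) in hO.
(* At v the power z^(j + 1) dominates; at the other poles of x every term on the right is regular;
   at places where x is regular, both terms on the left are. *)
have tE : (u j.+1).1 - (u i.+1).1 = z ^+ j.+1 + (- z ^+ i.+1 - h) by rewrite /h; ring.
exists ((u j.+1).1 - (u i.+1).1) => [|P Pv].
  rewrite tE; have [||_ ->] := @ord_addl _ v (z ^+ j.+1) (- z ^+ i.+1 - h).
  - by rewrite expf_neq0.
  - apply: ord_geB; last by apply: ord_ge_trans (hO v vx); rewrite ordX; nia.
    by apply: ord_geN; rewrite ord_geE ?expf_neq0 // !ordX; nia.
  - by rewrite ordX; nia.
have [Px|Px] := ltP (P x) 0; last first.
  by apply: ord_geB; apply: (hu _).1; apply: ord_ge_ge0.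
rewrite tE; apply: ord_geD; first by apply: ord_ge0X; apply: hz.
apply: ord_geB; last exact: hO.
by apply: ord_geN; apply: ord_ge0X; apply: hz.
Qed.

Variable v : place F.

Lemma regular_outsideP a :
  reflect (forall P, ord P <> ord v -> ord_ge P 0 a) (a \in regular_outside v).
Proof. exact: asboolP. Qed.

(** If t has v as its only pole, then k[t], and whatever is regular wherever t is, lies in the ring.
    So F is its fraction field. *)
Lemma regular_outside_fractions y : exists2 d : F,
  d \in regular_outside v /\ d != 0 & d * y \in regular_outside v.
Proof.
have [t vt ht] := exists_single_pole v.
have [d d0 hd] := integral_multiple y vt.
exists (ev t d); last by apply/regular_outsideP => P Pv; apply: hd; apply: ht.
split; last exact: peval_neq0 vt d0.
by apply/regular_outsideP => P Pv; apply: ord_ge_peval; apply: ht.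
Qed.

(** A form of the compactness of F_v / A, stated inside F. For [t] with v as its only pole, O is the
    valuation ring at v. *)
Lemma regular_outside_cocompact m :
  exists S : seq F, forall y, exists2 a, a \in regular_outside v &
    exists2 s, s \in S & ord_ge v m%:Z (y - a - s).
Proof.
have [t vt ht] := exists_single_pole v; have t0 := ord_lt0_neq0 vt.
have poles P : P t < 0 -> ord P = ord v.
  move=> Pt; apply: contrapT => /ht; rewrite ord_geE //; lia.
have [S hS] := cofinite_reduction vt m; exists S => y.
have [|b hb [s sS hs]] := hS `|v y|%N y.
  move=> P Pt; rewrite /ord_ge (poles P Pt) -/(ord_ge v 0 _).
  have [->|y0] := eqVneq y 0; first by rewrite mul0r ord_ge_0.
  by rewrite ord_ge_ge0 // ordM ?invr_neq0 ?expf_neq0 // ordV ordX; nia.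
exists b; first by apply/regular_outsideP => P Pv; apply: hb; apply: ht.
exists s => //; have [->|w0] := eqVneq (y - b - s) 0; first exact: ord_ge_0.
have := hs v vt; rewrite !ord_geE ?mulf_neq0 ?expf_neq0 // ordM ?expf_neq0 // ordX.
have : v t * m%:Z <= - m%:Z by nia.
by move=> h1 h2; rewrite -(lerD2l (v t * m%:Z)); apply: le_trans h2; rewrite -lerBrDr sub0r.
Qed.

End Places.

(** * Absolute values *)

Lemma finite_upper_bound (R : realType) (I : finType) (g : I -> R) :
  exists2 D : R, 0 < D & forall i, g i <= D.
Proof.
exists (1 + \sum_i `|g i|); first by rewrite ltr_pwDl // sumr_ge0.
move=> i; rewrite (bigD1 i) //= addrCA; apply: le_trans (ler_norm _) _.
by rewrite lerDl addr_ge0 // sumr_ge0.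
Qed.

Section Ultrametric.
Variables (R : realType) (V : zmodType) (N : V -> R).
Hypothesis N0 : N 0 = 0.
Hypothesis NN : forall x, N (- x) = N x.
Hypothesis ultra : forall x y, N (x + y) <= Num.max (N x) (N y).

Lemma ultra_sum (I : finType) (g : I -> V) r :
  0 <= r -> (forall i, N (g i) <= r) -> N (\sum_i g i) <= r.
Proof.
move=> r0 h; apply: (big_ind (fun z => N z <= r)) => //; first by rewrite N0.
by move=> y z hy hz; apply: le_trans (ultra _ _) _; rewrite ge_max hy.
Qed.

Lemma ultra_sum_lt (I : finType) (g : I -> V) r :
  0 < r -> (forall i, N (g i) < r) -> N (\sum_i g i) < r.
Proof.
move=> r0 h; apply: (big_ind (fun z => N z < r)) => //; first by rewrite N0.
by move=> y z hy hz; apply: le_lt_trans (ultra _ _) _; rewrite gt_max hy.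
Qed.

Lemma ultra_eq x y : N (x - y) < N x -> N y = N x.
Proof.
move=> lt; apply/eqP; rewrite eq_le; apply/andP; split.
  have := ultra x (- (x - y)); rewrite NN opprB addrC subrK => /le_trans -> //.
  by rewrite ge_max lexx ltW.
have := ultra (x - y) y; rewrite subrK le_max => /orP [|//].
by rewrite leNgt lt.
Qed.

End Ultrametric.

Section AbsoluteValue.
Variables (R : realType) (K : fieldType) (w : valuation K) (c : nat).
Hypothesis c1 : (1 < c)%N.
Local Notation abs := (absv w R c).

Let cR1 : 1 < c%:R :> R. Proof. by rewrite ltr1n. Qed.
Let cR0 : 0 < c%:R :> R. Proof. by rewrite ltr0n ltnW. Qed.

Lemma absv_ge0 x : 0 <= abs x.
Proof. by rewrite /absv; case: eqP => // _; rewrite exprz_ge0 ?ltW. Qed.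

Lemma absv0 : abs 0 = 0.
Proof. by rewrite /absv eqxx. Qed.

Lemma absv_gt0 x : x != 0 -> 0 < abs x.
Proof. by rewrite /absv => /negbTE ->; rewrite exprz_gt0. Qed.

Lemma absvM x y : abs (x * y) = abs x * abs y.
Proof.
have [->|x0] := eqVneq x 0; first by rewrite mul0r absv0 mul0r.
have [->|y0] := eqVneq y 0; first by rewrite mulr0 absv0 mulr0.
rewrite /absv mulf_eq0 (negbTE x0) (negbTE y0) ordM // opprD expfzDr //.
by rewrite gt_eqF.
Qed.

Lemma absv1 : abs 1 = 1.
Proof. by rewrite /absv oner_eq0 ord1 oppr0 expr0z. Qed.

Lemma absvN x : abs (- x) = abs x.
Proof. by rewrite /absv oppr_eq0 ordN. Qed.

Lemma absvV x : x != 0 -> abs x^-1 = (abs x)^-1.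
Proof.
move=> x0; have ax : abs x != 0 by rewrite gt_eqF ?absv_gt0.
by apply: (mulfI ax); rewrite -absvM !divff // absv1.
Qed.

Lemma absv_le_ord_ge n x : (abs x <= c%:R ^ (- n)) = ord_ge w n x.
Proof.
rewrite /absv /ord_ge; case: eqP => /= _; first by rewrite exprz_ge0 ?ltW.
by rewrite ler_eXz2l // lerN2.
Qed.

Lemma absv_ultra x y : abs (x + y) <= Num.max (abs x) (abs y).
Proof.
wlog xy : x y / abs x <= abs y.
  move=> h; have /orP [|] := le_total (abs x) (abs y); first exact: h.
  by rewrite addrC maxC; apply: h.
have [y0|y0] := eqVneq y 0.
  by rewrite y0 addr0 le_max lexx.
rewrite (max_idPr xy); move: xy; rewrite {2 4}/absv (negbTE y0).
by rewrite !absv_le_ord_ge => xy; apply: ord_geD xy (ord_ge_ord _ _).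
Qed.

Lemma absv_ge1 x : w x < 0 -> 1 <= abs x.
Proof.
move=> wx; rewrite /absv (negbTE (ord_lt0_neq0 wx)) -(expr0z (c%:R : R)).
by rewrite ler_eXz2l //; lia.
Qed.

Lemma absv_small e : 0 < e -> exists m : nat, forall x, ord_ge w m%:Z x -> abs x <= e.
Proof.
move=> e0; have ei : 0 <= e^-1 by rewrite invr_ge0 ltW.
exists (Num.bound e^-1) => x; rewrite -absv_le_ord_ge => /le_trans; apply.
rewrite -exprnN -[leRHS]invrK lef_pV2 ?posrE ?invr_gt0 ?exprn_gt0 //.
apply: ltW; apply: lt_trans (archi_boundP ei) _.
by rewrite -natrX ltr_nat ltn_expl.
Qed.

End AbsoluteValue.

(** The residue classes of 0 and 1 differ. Hence the absolute value has a base above 1. *)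
Lemma residue_card_gt1 (K : fieldType) (w : valuation K) (c : nat) :
  ([set: residue_field w] #= `I_c)%card -> (1 < c)%N.
Proof.
move=> /card_set_bijP [g [fg inj _]].
pose p : valuation_ring w -> residue_field w := (\pi_(residue_field w))%qT.
have ne : p 1 != p 0.
  by rewrite /p -Quotient.idealrBE subr0 unfold_in /ord_ge rmorph1 oner_eq0 ord1.
have g1 : g (p 1) != g (p 0).
  by apply: contra_neq ne => /inj; apply; rewrite in_setE.
have /= := fg (p 1) I; have /= := fg (p 0) I.
by move: (g _) (g _) g1 => a b; lia.
Qed.

(** * Extension of the norm *)

(** Projectivity splits the surjection from A^n given by generators; [e] and the coordinates of [h]
    form a dual basis. *)
Lemma fg_projective_retract (A : comNzRingType) (L : lmodType A) :
  finitely_generated L -> projective L ->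
  exists n (e : 'I_n -> L) (h : {linear L -> 'rV[A]_n}),
    forall l, l = \sum_i h l 0 i *: e i.
Proof.
move=> [n [e gen]] proj.
pose g (u : 'rV[A]_n) := \sum_i u 0 i *: e i.
have glin : linear g.
  move=> a u u'; rewrite /g scaler_sumr -big_split /=; apply: eq_bigr => i _.
  by rewrite !mxE scalerDl scalerA.
pose gl := GRing.isLinear.Build _ _ _ _ g glin.
pose G : {linear 'rV[A]_n -> L} := HB.pack g gl.
have [|h hh] := proj _ _ G (idfun : {linear L -> L}).
  move=> l; have [a ->] := gen l; exists (\row_i a i).
  by apply: eq_bigr => i _; rewrite mxE.
by exists n, e, h => l; rewrite -[LHS]hh.
Qed.

Lemma mulz_neg_ltn (z : int) (i j : nat) : z < 0 -> (i < j)%N -> z * j%:Z + 1 <= z * i%:Z.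
Proof. by nia. Qed.

(** * The tensor norm over a ring cocompact in K *)

Section NormExtension.
Variables (R : realType) (A : comNzRingType) (K : fieldType).
Variables (w : valuation K) (f : {rmorphism A -> K}) (c : nat).
Hypothesis c1 : (1 < c)%N.
Hypothesis pole : exists t, w (f t) < 0.
Hypothesis dense : forall y (m : nat), exists a d,
  f d != 0 /\ ord_ge w m%:Z (y - f a / f d).
Hypothesis cocompact : forall m : nat, exists S : seq K, forall y,
  exists a, exists2 s, s \in S & ord_ge w m%:Z (y - f a - s).
Variables (L : lmodType A) (nL : L -> R).
Local Notation abs := (absv w R c).
Hypothesis latticeL : is_lattice (fun a => abs (f a)) nL.
Variables (V : lmodType K) (t : K -> L -> V).
Hypothesis tensorV : is_tensor_product f t.

Lemma tensorDl x y l : t (x + y) l = t x l + t y l.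
Proof. by have [[]] := tensorV. Qed.

Lemma tensorDr x l l' : t x (l + l') = t x l + t x l'.
Proof. by have [[]] := tensorV. Qed.

Lemma tensorA x a l : t (x * f a) l = t x (a *: l).
Proof. by have [[]] := tensorV. Qed.

Lemma tensorZ x y l : x *: t y l = t (x * y) l.
Proof. by have [] := tensorV. Qed.

Lemma tensor0l l : t 0 l = 0.
Proof. by apply: (addrI (t 0 l)); rewrite -tensorDl !addr0. Qed.

Lemma tensor0r x : t x 0 = 0.
Proof. by apply: (addrI (t x 0)); rewrite -tensorDr !addr0. Qed.

Lemma tensor_sumr (I : finType) x (l : I -> L) : t x (\sum_i l i) = \sum_i t x (l i).
Proof. exact: (big_morph (t x) (tensorDr x) (tensor0r x)). Qed.

(** The dual basis of L extended to V. The [e i] may be dependent over A, so each [phi i] is induced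
    by a functional on L. *)
Lemma tensor_coordinates : exists n (e : 'I_n -> L) (h : L -> 'I_n -> A)
    (phi : 'I_n -> V -> K),
  [/\ forall l, l = \sum_i h l i *: e i,
      forall v, v = \sum_i t (phi i v) (e i),
      forall i m (z : 'I_m -> V), phi i (\sum_j z j) = \sum_j phi i (z j),
      forall i x v, phi i (x *: v) = x * phi i v &
      forall i x l, phi i (t x l) = x * f (h l i)].
Proof.
have [n [e [h he]]] := fg_projective_retract (lattice_fg latticeL) (lattice_proj latticeL).
have exphi (i : 'I_n) : exists phi : {additive V -> K},
    forall x l, phi (t x l) = x * f (h l 0 i).
  have [|phi hphi _] := tensor_univ tensorV (b := fun x l => x * f (h l 0 i)).
    split=> [x y l|x l l'|x a l]; first by rewrite mulrDl.
      by rewrite linearD mxE rmorphD mulrDr.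
    by rewrite linearZ mxE rmorphM mulrA.
  by exists phi.
have [phi hphi] := choice exphi.
pose psi v := \sum_i t (phi i v) (e i).
have psiD : zmod_morphism psi.
  move=> u v; rewrite /psi -sumrB; apply: eq_bigr => i _.
  rewrite raddfB; apply/eqP; rewrite eq_sym subr_eq -tensorDl subrK //.
pose psia := GRing.isZmodMorphism.Build _ _ psi psiD.
pose Psi : {additive V -> V} := HB.pack psi psia.
(* [psi] fixes pure tensors, hence everything, by uniqueness in the universal property. *)
have psiE v : v = psi v.
  have [g _ guniq] := tensor_univ tensorV (tensor_balanced tensorV).
  have idE : (idfun : {additive V -> V}) =1 g by apply: guniq.
  have psig : Psi =1 g.
    apply: guniq => x l /=; rewrite /psi [in RHS](he l) tensor_sumr.
    by apply: eq_bigr => i _; rewrite hphi tensorA.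
  by rewrite -[LHS]/(idfun v) idE -psig.
exists n, e, (fun l i => h l 0 i), (fun i v => phi i v); split=> //.
  by move=> i m z; rewrite raddf_sum.
(* The universal property yields additive maps; K-homogeneity is checked on the expansion in pure
   tensors. *)
move=> i x v; rewrite {1}(psiE v) {2}(psiE v) scaler_sumr !raddf_sum mulr_sumr.
by apply: eq_bigr => j _; rewrite tensorZ !hphi mulrA.
Qed.

Lemma lattice_norm0 : nL 0 = 0.
Proof. exact/(lattice_eq0 latticeL). Qed.

Lemma adic_normN N : is_adic_norm abs N -> forall v : V, N (- v) = N v.
Proof. by move=> NN v; rewrite -scaleN1r (adic_homog NN) absvN absv1 ?mul1r. Qed.

Lemma dense_family n (x : 'I_n -> K) (m : nat) : exists2 d, f d != 0 &
  exists a : 'I_n -> A, forall i, ord_ge w m%:Z (x i - f (a i) / f d).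
Proof.
have [a ha] := choice (fun i => dense (x i) m); have [d hd] := choice ha.
have d0 i : f (d i) != 0 by have [] := hd i.
exists (\prod_i d i); first by rewrite rmorph_prod; apply/prodf_neq0.
exists (fun i => a i * \prod_(j | j != i) d j) => i.
have [_] := hd i; congr (ord_ge w _ (_ - _)).
have -> : \prod_j d j = d i * \prod_(j | j != i) d j by rewrite (bigD1 i).
rewrite !rmorphM.
have p0 : f (\prod_(j | j != i) d j) != 0 by rewrite rmorph_prod; apply/prodf_neq0.
by field; rewrite d0 p0.
Qed.

(** The condition 0 <= r matters for the empty expression of 0, which would otherwise admit every
    real bound. *)
Definition expression_bounds (v : V) : set R := [set r | 0 <= r /\
  exists n (x : 'I_n -> K) (l : 'I_n -> L),
    v = \sum_j t (x j) (l j) /\ forall j, abs (x j) * nL (l j) <= r].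

Definition tensor_norm (v : V) : R := inf (expression_bounds v).

Lemma tensor_norm_le v r : expression_bounds v r -> tensor_norm v <= r.
Proof. by move=> h; apply: ge_inf h; exists 0 => s []. Qed.

Lemma expression_bounds_nonempty v : expression_bounds v !=set0.
Proof.
have [n [e [h [phi [_ vE _ _ _]]]]] := tensor_coordinates.
have [D D0 hD] := finite_upper_bound (fun i => abs (phi i v) * nL (e i)).
by exists D; split; [exact: ltW|exists n, (fun i => phi i v), e].
Qed.

Lemma expression_boundsW v r r' : r <= r' ->
  expression_bounds v r -> expression_bounds v r'.
Proof.
move=> rr' [r0 [n [x [l [vE h]]]]]; split; first exact: le_trans rr'.
by exists n, x, l; split=> // j; apply: le_trans rr'.
Qed.

Lemma tensor_norm_lt v r : tensor_norm v < r -> expression_bounds v r.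
Proof.
move=> /(inf_lt (expression_bounds_nonempty v)) [s hs /ltW sr].
exact: expression_boundsW hs.
Qed.

Lemma tensor_norm_ge0 v : 0 <= tensor_norm v.
Proof. by apply: lb_le_inf; [exact: expression_bounds_nonempty|move=> s []]. Qed.

(** Near-optimal expressions of u and v, concatenated, express u + v. *)
Lemma tensor_norm_ultra u v :
  tensor_norm (u + v) <= Num.max (tensor_norm u) (tensor_norm v).
Proof.
apply/ler_addgt0Pl => e e0; apply: tensor_norm_le.
set r := (X in expression_bounds _ X).
have lt : Num.max (tensor_norm u) (tensor_norm v) < r by rewrite ltrDr.
move: lt; rewrite gt_max => /andP [/tensor_norm_lt [r0 [n [x [l [-> h]]]]]].
move=> /tensor_norm_lt [_ [n' [x' [l' [-> h']]]]]; split=> //.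
pose cat T (g : 'I_n -> T) (g' : 'I_n' -> T) (i : 'I_(n + n')) :=
  match fintype.split i with inl j => g j | inr j => g' j end.
exists (n + n')%N, (cat _ x x'), (cat _ l l'); split.
  rewrite big_split_ord /=; congr (_ + _); apply: eq_bigr => i _.
    by rewrite /cat (unsplitK (inl i)).
  by rewrite /cat (unsplitK (inr i)).
by move=> i; rewrite /cat; case: fintype.split.
Qed.

Lemma tensor_norm_tensor_le x l : tensor_norm (t x l) <= abs x * nL l.
Proof.
apply: tensor_norm_le; split; first by rewrite mulr_ge0 ?absv_ge0 ?(lattice_ge0 latticeL).
by exists 1%N, (fun=> x), (fun=> l); rewrite big_ord1; split.
Qed.

(** Scaling expressions by x gives one inequality, and scaling by x^-1 the other. *)
Lemma tensor_normZ x v : tensor_norm (x *: v) = abs x * tensor_norm v.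
Proof.
have norm0 : tensor_norm 0 = 0.
  apply/eqP; rewrite eq_le tensor_norm_ge0 andbT -(tensor0l 0).
  by apply: le_trans (tensor_norm_tensor_le _ _) _; rewrite absv0 mul0r.
have [->|x0] := eqVneq x 0; first by rewrite scale0r absv0 mul0r.
have half y u : y != 0 -> tensor_norm (y *: u) <= abs y * tensor_norm u.
  move=> y0; have ay := absv_gt0 R w c1 y0.
  rewrite mulrC -ler_pdivrMr //; apply/ler_addgt0Pl => e e0.
  rewrite ler_pdivrMr // mulrC; apply: tensor_norm_le.
  have /tensor_norm_lt [r0 [n [z [l [uE h]]]]] : tensor_norm u < e + tensor_norm u.
    by rewrite ltrDr.
  split; first by rewrite mulr_ge0 // ltW.
  exists n, (fun j => y * z j), l; split.
    by rewrite [in LHS]uE scaler_sumr; apply: eq_bigr => j _; rewrite tensorZ.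
  by move=> j; rewrite absvM // -mulrA ler_pM2l.
apply/eqP; rewrite eq_le half //=.
have := half x^-1 (x *: v) (invr_neq0 x0); rewrite scalerA mulVf // scale1r absvV //.
by rewrite mulrC ler_pdivlMr ?absv_gt0 // mulrC.
Qed.

Lemma tensor1Z a l : t 1 (a *: l) = f a *: t 1 l.
Proof. by rewrite tensorZ mulr1 -tensorA mul1r. Qed.

(* Approximating the x_j by fractions a_j / d, the difference mu between d l and
   the sum of a_j l_j has small coordinates, hence small norm. *)
Lemma tensor_norm_extends l : tensor_norm (t 1 l) = nL l.
Proof.
apply/eqP; rewrite eq_le; apply/andP; split.
  by apply: le_trans (tensor_norm_tensor_le _ _) _; rewrite absv1 // mul1r.
apply: lb_le_inf; first exact: expression_bounds_nonempty.
move=> r [r0 [n [x [lam [lE hr]]]]]; rewrite leNgt; apply/negP => lt.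
have nl0 : 0 < nL l by apply: le_lt_trans lt.
have [p [e [h [phi [he _ phi_sum phiZ phit]]]]] := tensor_coordinates.
have [C C0 hC] := finite_upper_bound (fun i => nL (e i)).
have [E E0 hE] := finite_upper_bound (fun j => nL (lam j)).
have [D D0 hD] := finite_upper_bound (fun u : 'I_n * 'I_p => abs (f (h (lam u.1) u.2))).
(* The term eps E controls the errors on the a_j, and eps C D the norm of mu. *)
have [eps eps0 epsE] : exists2 eps, 0 < eps & eps * (E + C * D) < nL l.
  have EC0 : 0 < E + C * D by rewrite addr_gt0 // mulr_gt0.
  exists (nL l / 2 / (E + C * D)); first by rewrite !divr_gt0.
  by rewrite divfK ?gt_eqF //; lra.
have [Cw Dw Ew epsw] := And4 (ltW C0) (ltW D0) (ltW E0) (ltW eps0).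
have [m hm] := absv_small w c1 eps0.
have [d fd0 [a ha]] := dense_family x m.
have afd := absv_gt0 R w c1 fd0.
pose mu := d *: l - \sum_j a j *: lam j.
have phi1 i u : phi i (t 1 u) = f (h u i) by rewrite phit mul1r.
have muE : t 1 mu = f d *: \sum_j t (x j - f (a j) / f d) (lam j).
  rewrite /mu -scaleN1r tensorDr !tensor1Z lE rmorphN1 scaleN1r tensor_sumr.
  rewrite scaler_sumr [in RHS]scaler_sumr -sumrB; apply: eq_bigr => j _.
  rewrite !tensorZ tensor1Z tensorZ mulr1.
  have -> : f d * (x j - f (a j) / f d) = f d * x j - f (a j) by field.
  by apply/eqP; rewrite subr_eq -tensorDl subrK.
have hmu i : abs (f (h mu i)) <= abs (f d) * (eps * D).
  rewrite -phi1 muE phiZ absvM // ler_pM2l // phi_sum.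
  apply: (ultra_sum (absv0 R w c) (absv_ultra R w c1)); first by rewrite mulr_ge0.
  move=> j; rewrite phit absvM // ler_pM ?absv_ge0 //; last exact: (hD (j, i)).
  by apply: hm; apply: ha.
have nmu : nL mu < abs (f d) * nL l.
  rewrite (he mu); apply: le_lt_trans (_ : _ <= abs (f d) * (eps * D) * C) _.
    apply: (ultra_sum lattice_norm0 (lattice_ultra latticeL)).
      by do ?apply: mulr_ge0; rewrite ?absv_ge0.
    move=> i; rewrite (lattice_homog latticeL).
    by apply: ler_pM; rewrite ?absv_ge0 ?(lattice_ge0 latticeL).
  rewrite -mulrA ltr_pM2l //; apply: le_lt_trans epsE.
  by rewrite -mulrA ler_pM2l // mulrC lerDr ltW.
(* a_j is f(d) x_j up to a small error, and |x_j| times the norm of l_j is at most r, below the norm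
   of l. *)
have nsum : nL (\sum_j a j *: lam j) < abs (f d) * nL l.
  apply: (ultra_sum_lt lattice_norm0 (lattice_ultra latticeL)); first exact: mulr_gt0.
  move=> j; rewrite (lattice_homog latticeL).
  have -> : f (a j) = f d * (x j - (x j - f (a j) / f d)) by field.
  rewrite absvM // -mulrA ltr_pM2l //.
  have [nlam|nlam] := eqVneq (nL (lam j)) 0; first by rewrite nlam mulr0.
  have nlam0 : 0 < nL (lam j) by rewrite lt_neqAle eq_sym nlam (lattice_ge0 latticeL).
  rewrite -ltr_pdivlMr //; apply: le_lt_trans (absv_ultra R w c1 _ _) _.
  rewrite gt_max absvN // !ltr_pdivlMr // (le_lt_trans (hr j)) //=.
  apply: le_lt_trans epsE; rewrite mulrDr.
  apply: le_trans (_ : eps * E <= _); last by rewrite lerDl; do ?apply: mulr_ge0.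
  by apply: ler_pM; rewrite ?absv_ge0 ?(ltW nlam0) // hm.
have := lattice_ultra latticeL mu (\sum_j a j *: lam j).
rewrite subrK (lattice_homog latticeL) => /le_lt_trans.
by move=> /(_ (abs (f d) * nL l)); rewrite gt_max nmu nsum ltxx => /(_ isT).
Qed.

(* If v had norm 0, the infinitely many vectors tau^j v would all be congruent,
   modulo Lambda, to vectors in a bounded, hence totally bounded, region; a
   difference of two of them would be a small nonzero lattice vector. *)
Lemma tensor_norm_eq0 v : tensor_norm v = 0 -> v = 0.
Proof.
move=> Nv; apply/eqP; apply: contrapT => /negP v0.
have [n [e [h [phi [he vE phi_sum phiZ phit]]]]] := tensor_coordinates.
have [i0 phi0] : exists i, phi i v != 0.
  apply: contrapT => no; case/eqP: v0; rewrite (vE v) big1 // => i _.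
  suff -> : phi i v = 0 by rewrite tensor0l.
  by apply/eqP; apply: contrapT => /negP ne; apply: no; exists i.
have b0 := absv_gt0 R w c1 phi0.
have [e0 e00 discr] := lattice_discrete latticeL 0.
have [C C0 hC] := finite_upper_bound (fun i => nL (e i)).
have [D D0 hD] := finite_upper_bound (fun u : 'I_n * 'I_n => abs (f (h (e u.1) u.2))).
(* eps C below the isolation radius [e0] will kill the lattice part; eps D will contradict the size
   of the nonzero coordinate. *)
have [eps eps0 [epsC epsD]] : exists2 eps, 0 < eps &
    eps * C < e0 /\ eps * D < abs (phi i0 v).
  pose q := Num.min (e0 / C) (abs (phi i0 v) / D).
  have q0 : 0 < q by rewrite lt_min !divr_gt0.
  exists (q / 2); first by rewrite divr_gt0.
  have q2 : q / 2 < q by lra.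
  by split; rewrite -ltr_pdivlMr //; apply: lt_le_trans q2 _; rewrite ge_min lexx ?orbT.
have [Cw Dw epsw] := And3 (ltW C0) (ltW D0) (ltW eps0).
have [m hm] := absv_small w c1 eps0.
have [S hS] := cocompact m; have [tau htau] := pole.
have [a ha] := choice (fun u : nat * 'I_n => hS (f tau ^+ u.1 * phi u.2 v)).
have has (u : nat * 'I_n) : exists s, s \in S /\
    ord_ge w m%:Z (f tau ^+ u.1 * phi u.2 v - f (a u) - s).
  by have [s ? ?] := ha u; exists s.
have [s hs] := choice has.
(* [code j] records the class of every coordinate of tau^j v; the successor keeps the ordinal type
   inhabited for [inord]. *)
pose code j : {ffun 'I_n -> 'I_(size S).+1} := [ffun i => inord (index (s (j, i)) S)].
have [j [j' [jj' codeE]]] :=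
  pigeonhole (fun j => mem_enum {ffun 'I_n -> 'I_(size S).+1} (code j)).
have sE i : s (j, i) = s (j', i).
  have := congr1 (fun g : {ffun _ -> _} => val (g i)) codeE.
  have [sj _] := hs (j, i); have [sj' _] := hs (j', i).
  rewrite !ffunE /= !inordK ?ltnS ?index_size // => ie.
  by rewrite -(nth_index 0 sj) ie nth_index.
pose lam := \sum_i (a (j', i) - a (j, i)) *: e i.
pose del := f tau ^+ j' - f tau ^+ j.
pose r i := del * phi i v - f (a (j', i) - a (j, i)).
have hr i : abs (r i) <= eps.
  apply: hm; have [_ h1] := hs (j, i); have [_ h2] := hs (j', i).
  by have := ord_geB h2 h1; rewrite sE /r /del rmorphB; congr (ord_ge w _); rewrite /=; ring.
have dv : del *: v = t 1 lam + \sum_i t (r i) (e i).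
  rewrite [in LHS](vE v) scaler_sumr tensor_sumr -big_split /=; apply: eq_bigr => i _.
  by rewrite -tensorA mul1r -tensorDl tensorZ /r addrC subrK.
have normN u : tensor_norm (- u) = tensor_norm u.
  by rewrite -scaleN1r tensor_normZ absvN absv1 ?mul1r.
have norm0 : tensor_norm 0 = 0 by rewrite -(scale0r (0 : V)) tensor_normZ absv0 mul0r.
have small : tensor_norm (\sum_i t (r i) (e i)) <= eps * C.
  apply: (ultra_sum norm0 tensor_norm_ultra); first exact: mulr_ge0.
  move=> i; apply: le_trans (tensor_norm_tensor_le _ _) _.
  by apply: ler_pM; rewrite ?absv_ge0 ?(lattice_ge0 latticeL).
(* del v has norm 0, so [lam] is no longer than the remainder, whose norm is at most eps C. *)
have lam0 : lam = 0.
  apply: discr; rewrite subr0 -tensor_norm_extends; apply: le_lt_trans epsC.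
  have -> : t 1 lam = del *: v - \sum_i t (r i) (e i) by rewrite dv addrK.
  apply: le_trans (tensor_norm_ultra _ _) _.
  by rewrite ge_max normN small tensor_normZ Nv mulr0 mulr_ge0.
(* With lam = 0 this coordinate of del v is small, although |del| >= 1 because tau has a pole and j
   < j'. *)
have : abs (del * phi i0 v) < abs (phi i0 v).
  apply: le_lt_trans epsD; rewrite -phiZ dv lam0 tensor0r add0r phi_sum.
  apply: (ultra_sum (absv0 R w c) (absv_ultra R w c1)); first exact: mulr_ge0.
  move=> i; rewrite phit absvM //.
  by apply: ler_pM; rewrite ?absv_ge0 //; apply: (hD (i, i0)).
apply/negP; rewrite -leNgt absvM // ler_peMl ?absv_ge0 //; apply: absv_ge1 => //.
have tau0 := ord_lt0_neq0 htau.
have [||_ ->] := @ord_addl _ w (f tau ^+ j') (- f tau ^+ j).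
- by rewrite expf_neq0.
- by apply: ord_geN; rewrite ord_geE ?expf_neq0 // !ordX mulz_neg_ltn.
- by rewrite ordX nmulr_rlt0 // ltz_nat (leq_ltn_trans _ jj').
Qed.

Lemma tensor_norm_adic : is_adic_norm abs tensor_norm.
Proof.
split; [exact: tensor_norm_ge0| |exact: tensor_norm_ultra|exact: tensor_normZ].
move=> v; split; first exact: tensor_norm_eq0.
by move=> ->; rewrite -(scale0r (0 : V)) tensor_normZ absv0 mul0r.
Qed.

(* F-rational vectors sum (a_i / d) (x) e_i are dense, and there the norm is forced. *)
Lemma adic_extension_unique (N1 N2 : V -> R) :
  is_adic_norm abs N1 -> is_adic_norm abs N2 ->
  (forall l, N1 (t 1 l) = nL l) -> (forall l, N2 (t 1 l) = nL l) -> N1 =1 N2.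
Proof.
move=> A1 A2 E1 E2 v.
have [v0|v0] := eqVneq v 0.
  by rewrite v0 ((adic_eq0 A1 0).2 erefl) ((adic_eq0 A2 0).2 erefl).
have pos N : is_adic_norm abs N -> 0 < N v.
  move=> AN; rewrite lt_neqAle eq_sym (adic_ge0 AN) andbT.
  by apply: contra_neq v0 => /(adic_eq0 AN).
have [n [e [h [phi [_ vE _ _ _]]]]] := tensor_coordinates.
have [C C0 hC] := finite_upper_bound (fun i => nL (e i)).
(* The factor 2 makes q C strictly smaller than both norms of v. *)
pose q := Num.min (N1 v) (N2 v) / (2 * C).
have min0 : 0 < Num.min (N1 v) (N2 v) by rewrite lt_min !pos.
have q0 : 0 < q by rewrite divr_gt0 // mulr_gt0.
have qC : q * C < Num.min (N1 v) (N2 v).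
  by rewrite /q invfM mulrA divfK ?gt_eqF //; lra.
have [m hm] := absv_small w c1 q0.
have [d d0 [a ha]] := dense_family (fun i => phi i v) m.
pose u := \sum_i t (f (a i) / f d) (e i).
(* v - u is shorter than v, so N(u) = N(v), and N(u) is dictated by the norm on L. *)
have key N : is_adic_norm abs N -> (forall l, N (t 1 l) = nL l) -> q * C < N v ->
    N v = abs (f d)^-1 * nL (\sum_i a i *: e i).
  move=> AN EN lt; rewrite -(EN (\sum_i _)) -(adic_homog AN).
  have -> : (f d)^-1 *: t 1 (\sum_i a i *: e i) = u.
    rewrite tensor_sumr scaler_sumr; apply: eq_bigr => i _.
    by rewrite -tensorA mul1r tensorZ mulrC.
  apply/esym; apply: (ultra_eq (adic_normN AN) (adic_ultra AN)).
  apply: le_lt_trans lt; have -> : v - u = \sum_i t (phi i v - f (a i) / f d) (e i).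
    rewrite [in LHS](vE v) /u -sumrB; apply: eq_bigr => i _.
    by apply/eqP; rewrite subr_eq -tensorDl subrK.
  apply: (ultra_sum ((adic_eq0 AN 0).2 erefl) (adic_ultra AN)); first by rewrite mulr_ge0 ?ltW.
  move=> i; have -> : N (t (phi i v - f (a i) / f d) (e i)) =
      abs (phi i v - f (a i) / f d) * nL (e i).
    by rewrite -EN -(adic_homog AN) tensorZ mulr1.
  by apply: ler_pM; rewrite ?absv_ge0 ?(lattice_ge0 latticeL) // hm.
have lt1 : q * C < N1 v by apply: lt_le_trans qC _; rewrite ge_min lexx.
have lt2 : q * C < N2 v by apply: lt_le_trans qC _; rewrite ge_min lexx orbT.
by rewrite (key _ A1 E1 lt1) (key _ A2 E2 lt2).
Qed.

End NormExtension.

Theorem theorem1p10 (R : realType)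
  (k : finFieldType) (F : fieldExtType {fraction {poly k}})
  (infty : place F)
  (Finf : fieldType) (vinf : valuation Finf) (iota : {rmorphism F -> Finf})
  (Finf_completion : is_completion infty vinf iota)
  (c : nat) (c_card : ([set: residue_field vinf] #= `I_c)%card)
  (Lambda : lmodType (regular_ring infty)) (nLambda : Lambda -> R)
  (Lambda_lattice :
     is_lattice (fun a : regular_ring infty => absv vinf R c (iota (val a)))
       nLambda)
  (Vinf : lmodType Finf) (tensor : Finf -> Lambda -> Vinf)
  (Vinf_tensor :
     is_tensor_product (fun a : regular_ring infty => iota (val a)) tensor) :
  exists! nV : Vinf -> R,
    is_adic_norm (absv vinf R c) nV /\
    forall l : Lambda, nV (tensor 1 l) = nLambda l.
Proof.
pose el a (aA : a \in regular_outside infty) : regular_ring infty := exist _ a aA.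
have c1 := residue_card_gt1 c_card.
have dep := @function_field_poly_dependent k F.
pose f : {rmorphism regular_ring infty -> Finf} :=
  (iota \o (val : regular_ring infty -> F))%FUN.
have ext n x : ord_ge vinf n (iota x) = ord_ge infty n x.
  by rewrite /ord_ge fmorph_eq0 (completion_ext Finf_completion).
have pole : exists t, vinf (f t) < 0.
  have [t vt ht] := exists_single_pole dep infty.
  have tA : t \in regular_outside infty by apply/regular_outsideP.
  by exists (el t tA); rewrite /f /= (completion_ext Finf_completion).
(* F is dense in its completion and is the fraction field of A. *)
have dense y (m : nat) : exists a d, f d != 0 /\ ord_ge vinf m%:Z (y - f a / f d).
  have [x hx] := completion_dense Finf_completion y m%:Z.
  have [d [dA d0] aA] := regular_outside_fractions dep infty x.
  exists (el _ aA), (el _ dA); rewrite /f /= fmorph_eq0; split=> //.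
  by rewrite rmorphM mulrAC divff ?mul1r // fmorph_eq0.
have cocompact (m : nat) : exists S : seq Finf, forall y,
    exists a, exists2 s, s \in S & ord_ge vinf m%:Z (y - f a - s).
  have [S hS] := regular_outside_cocompact dep infty m.
  (* Approximating y to order m by some x in F reduces the claim to F, since [iota] preserves
     orders. *)
  exists [seq iota s | s <- S] => y.
  have [x hx] := completion_dense Finf_completion y m%:Z.
  have [a aA [s sS hs]] := hS x.
  exists (el a aA); exists (iota s); first exact: map_f.
  rewrite /f /=; have -> : y - iota a - iota s = (y - iota x) + iota (x - a - s).
    by rewrite !rmorphB; ring.
  by apply: ord_geD hx _; rewrite ext.
have A1 := @tensor_norm_adic R _ _ vinf f c c1 pole dense cocompact
  _ _ Lambda_lattice _ _ Vinf_tensor.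
have E1 := @tensor_norm_extends R _ _ vinf f c c1 dense
  _ _ Lambda_lattice _ _ Vinf_tensor.
exists (tensor_norm vinf c nLambda tensor); split=> // N [A2 E2].
apply/funext; apply: (adic_extension_unique c1 dense Lambda_lattice Vinf_tensor) => //.
Qed.
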